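(* For every back-front shuffling method $\Sigma$ and every $n\ge 2$, $$p_n(\mathbb{Q}_{\Sigma}^{\textsf{pop}}) = F_{2n-1},$$ where $F_i$ is the $i$-th Fibonacci number with $F_1=F_2=1$.
   Context: Permutations are written in one-line notation; $S_n$ is the set of permutations of $[n]=\{1,\dots,n\}$, $id_n = 12\cdots n$, and $\varepsilon$ is the empty sequence. A shuffling method $\Sigma$ is a family of sets $\Pi_{\Sigma}^{n}\subseteq S_n$, $n\ge 2$, with $id_n\notin\Pi_{\Sigma}^{n}$ for all $n\geq 2$. It is back-front if for every $n\ge 2$ we have $\Pi_{\Sigma}^{n}=\{\sigma_n\}$ for a single permutation $\sigma_n\in S_n$ with $\sigma_n(1)=n$. The pop shuffle queue $\mathbb{Q}_{\Sigma}^{\textsf{pop}}$ processes configurations $(s_{inp},s_{dev},s_{out})$ of three sequences (input, content of the device, output), starting from $(\pi,\varepsilon,\varepsilon)$ and ending at $(\varepsilon,\varepsilon,\pi')$, using freely chosen operations: push (move the first element of the input to the end of $s_{dev}$); pop (append the entire non-empty content $s_{dev}$, in order, to the end of the output, leaving the device empty); shuffle (if $s_{dev}=s_1\cdots s_m$ with $m\ge2$, choose $\sigma\in\Pi_{\Sigma}^{m}$ and replace the content by $s_{\sigma(1)}\cdots s_{\sigma(m)}$). A shuffle may not be applied immediately after another shuffle. $p_n(\mathbb{Q}_{\Sigma}^{\textsf{pop}})$ is the number of $\pi\in S_n$ for which the final output $\pi'=id_n$ can be achieved. *)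

(* Defs.v *)
From mathcomp Require Import all_boot all_fingroup.
From mathcomp Require Import boolp.

Set Implicit Arguments.
Unset Strict Implicit.
Unset Printing Implicit Defensive.

(* Throughout, [n] = {1, ..., n} is rendered as 'I_n = {0, ..., n-1}. *)

Definition one_line (n : nat) (p : 'S_n) : seq 'I_n :=
  [seq p i | i <- enum 'I_n].

(* The values at n = 0 and n = 1 are never used: the queue below only shuffles
   contents of length at least 2. *)
Record shuffling_method := ShufflingMethod {
  shuffles :> forall n : nat, {set 'S_n};
  shuffles_id : forall n : nat, 2 <= n -> 1%g \notin shuffles n }.

Definition back_front (Sigma : shuffling_method) : Prop :=
  forall n : nat, exists2 sigma : 'S_n.+2,
    Sigma n.+2 = [set sigma] & sigma ord0 = ord_max.

(* s_1 ... s_m |-> s_{sigma(1)} ... s_{sigma(m)} *)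
Definition permute (T : Type) (s : seq T) (sigma : 'S_(size s)) : seq T :=
  [seq tnth (in_tuple s) (sigma i) | i <- enum 'I_(size s)].

Record config (T : Type) := Config {
  inp : seq T;
  dev : seq T;
  out : seq T }.

Variant operation := Push | Pop | Shuffle.

Definition is_shuffle (o : operation) : bool :=
  if o is Shuffle then true else false.

Variant pop_queue_step (Sigma : shuffling_method) (T : Type) :
    operation -> config T -> config T -> Prop :=
| StepPush x i d o :
    pop_queue_step Sigma Push (Config (x :: i) d o) (Config i (rcons d x) o)
| StepPop i d o of 0 < size d :
    pop_queue_step Sigma Pop (Config i d o) (Config i [::] (o ++ d))
| StepShuffle i d o (sigma : 'S_(size d)) of 2 <= size d & sigma \in Sigma (size d) :
    pop_queue_step Sigma Shuffle (Config i d o) (Config i (permute sigma) o).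

Inductive pop_queue_run (Sigma : shuffling_method) (T : Type) :
    seq operation -> config T -> config T -> Prop :=
| RunNil c : pop_queue_run Sigma [::] c c
| RunCons a ops c1 c2 c3 of
    pop_queue_step Sigma a c1 c2 & pop_queue_run Sigma ops c2 c3 :
    pop_queue_run Sigma (a :: ops) c1 c3.

Definition no_consecutive_shuffles (ops : seq operation) : bool :=
  sorted (fun a b => ~~ (is_shuffle a && is_shuffle b)) ops.

Definition pop_queue_sortable (Sigma : shuffling_method) (n : nat) (p : 'S_n) :
    Prop :=
  exists2 ops : seq operation, no_consecutive_shuffles ops &
    pop_queue_run Sigma ops (Config (one_line p) [::] [::])
                            (Config [::] [::] (one_line 1%g)).

Definition pop_queue_count (Sigma : shuffling_method) (n : nat) : nat :=
  #|[set p : 'S_n | `[< pop_queue_sortable Sigma p >]]|.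

Fixpoint fib (n : nat) : nat :=
  match n with
  | 0 => 0
  | 1 => 1
  | (m.+1 as k).+1 => fib k + fib m
  end.

(* Main.v *)
Require Import Defs.
From mathcomp Require Import all_boot all_fingroup.
From mathcomp Require Import boolp zify.

(** The content of the device is popped as a whole, so a run splits the input
    into consecutive blocks, and inside a block the only freedom is whether to
    shuffle after each push.  If a block is popped right after a push, its
    last letter could equally well have been processed as a block of its own,
    after popping the others.  Iterating this, every output is produced by a
    canonical run, in which each block is either a single letter or ends with a
    shuffle at length at least 2.

    Canonical runs on [n] letters form the paths of a two-state automaton.
    Writing D for the number that leave the device empty and N for the number
    that leave it non-empty, one more letter gives D' = D + N and
    N' = D + 2 N, whence D + N = F_(2n+1) and N = F_(2n) ([size_canonical]).

    Distinct canonical runs have distinct results ([uniq_canonical]), and this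
    is where the back-front hypothesis enters: a shuffle performed just after
    the letter [n] was pushed puts [n] first ([shuffle_rcons]), while without
    it [n] is last.  The position of [n] therefore reveals the last move and,
    after a pop, the start of the last block; the shuffle being injective, the
    move can be undone.

    Finally a run does not look at the letters ([run_map]): the queue sorts [p]
    exactly when it turns the identity into the inverse of [p]
    ([sortable_identity_run]), so sortable permutations are as many as the
    outputs that can be produced from the identity. *)

(** * The shuffle as a function *)

(** The choice of a default makes this total; only lengths at least 2 matter,
    where a back-front method leaves a single choice. *)
Definition the_shuffle (Sigma : shuffling_method) (m : nat) : 'S_m :=
  odflt 1%g [pick sigma in Sigma m].

Definition shuffle (Sigma : shuffling_method) {T : Type} (s : seq T) : seq T :=
  permute (the_shuffle Sigma (size s)).

Lemma back_front_set (Sigma : shuffling_method) (m : nat) :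
  back_front Sigma -> 2 <= m -> Sigma m = [set the_shuffle Sigma m].
Proof.
case: m => [|[|m]] // bfS _; have [sigma Esigma _] := bfS m.
rewrite /the_shuffle; case: pickP => [tau|/(_ sigma)] /=; last first.
  by rewrite Esigma set11.
by rewrite Esigma => /set1P ->.
Qed.

Lemma the_shuffle0 (Sigma : shuffling_method) (m : nat) :
  back_front Sigma -> the_shuffle Sigma m.+2 ord0 = ord_max.
Proof.
move=> bfS; have [sigma Esigma sigma0] := bfS m.
move: (@back_front_set Sigma m.+2 bfS isT).
by rewrite Esigma => /set1_inj <-.
Qed.

(** Unlike the definition, this form has no type depending on [size s], so
    that sizes can be rewritten in it. *)
Lemma shuffleE (Sigma : shuffling_method) {T : Type} (x0 : T) (s : seq T) :
  shuffle Sigma s =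
  [seq nth x0 s (the_shuffle Sigma (size s) i) | i <- enum 'I_(size s)].
Proof. by apply: eq_map => i; rewrite (tnth_nth x0). Qed.

Lemma shuffle_map (Sigma : shuffling_method) {T U : Type} (f : T -> U)
    (s : seq T) :
  shuffle Sigma (map f s) = map f (shuffle Sigma s).
Proof.
case: s => [|x s]; first by rewrite /shuffle /permute /= enum_ord0.
rewrite (shuffleE _ (f x)) size_map (shuffleE _ x) -map_comp.
by apply: eq_map => i; rewrite /= -map_cons (nth_map x).
Qed.

Lemma perm_shuffle (Sigma : shuffling_method) {T : eqType} (s : seq T) :
  perm_eq (shuffle Sigma s) s.
Proof.
apply/(@tuple_permP _ _ _ (in_tuple s)).
by exists (the_shuffle Sigma (size s)).
Qed.

Lemma size_shuffle (Sigma : shuffling_method) {T : Type} (s : seq T) :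
  size (shuffle Sigma s) = size s.
Proof. by rewrite size_map size_enum_ord. Qed.

Lemma shuffle_inj (Sigma : shuffling_method) {T : Type} :
  injective (@shuffle Sigma T).
Proof.
move=> s t Est.
have Esz : size s = size t by rewrite -(size_shuffle Sigma) Est size_shuffle.
case: s t Esz Est => [|x s] [|y t] //= Esz Est.
apply: (@eq_from_nth _ x) => //= i lt_i.
set m := (size s).+1 in lt_i.
pose j := ((the_shuffle Sigma m)^-1)%g (Ordinal lt_i).
have Enth u : size u = m -> nth x u i = nth x (shuffle Sigma u) j.
  move=> Eu; rewrite (shuffleE _ x) Eu.
  by rewrite (nth_map j) ?size_enum_ord // nth_ord_enum permKV.
by rewrite !Enth ?Est //= -Esz.
Qed.

(** The form in which the back-front property separates canonical runs: a letter
    just pushed to a non-empty device moves from the end to the front. *)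
Lemma shuffle_rcons (Sigma : shuffling_method) {T : eqType} (d : seq T) (x : T) :
  back_front Sigma -> d != [::] ->
  exists2 t, shuffle Sigma (rcons d x) = x :: t & perm_eq t d.
Proof.
move=> bfS d_neq0.
have [t Et] : exists t, shuffle Sigma (rcons d x) = x :: t.
  rewrite (shuffleE _ x) size_rcons.
  case: d d_neq0 => [|y d] //= _; rewrite enum_ordSl /= the_shuffle0 //.
  by eexists; rewrite /= nth_rcons ltnn eqxx.
exists t => //; rewrite -(perm_cons x) -Et.
by rewrite (permPl (perm_shuffle _ _)) perm_rcons.
Qed.

(** * Canonical runs *)

(** The first component lists the outputs of the canonical runs on the letters
    0, ..., n-1 that leave the device empty; the second lists the pairs
    (output, non-empty device content) at which canonical runs may stand when
    they have not finished their last block. *)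
Fixpoint canonical (Sigma : shuffling_method) (n : nat) :
    seq (seq nat) * seq (seq nat * seq nat) :=
  if n is m.+1 then
    let: (D, N) := canonical Sigma m in
    ([seq rcons o m | o <- D] ++
     [seq od.1 ++ shuffle Sigma (rcons od.2 m) | od <- N],
     [seq (o, [:: m]) | o <- D] ++
     ([seq (od.1, rcons od.2 m) | od <- N] ++
      [seq (od.1, shuffle Sigma (rcons od.2 m)) | od <- N]))
  else ([:: [::]], [::]).

Definition closed_runs (Sigma : shuffling_method) (n : nat) := (canonical Sigma n).1.
Definition open_runs (Sigma : shuffling_method) (n : nat) := (canonical Sigma n).2.

Lemma closed_runsS (Sigma : shuffling_method) (n : nat) :
  closed_runs Sigma n.+1 =
  [seq rcons o n | o <- closed_runs Sigma n] ++
  [seq od.1 ++ shuffle Sigma (rcons od.2 n) | od <- open_runs Sigma n].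
Proof. by rewrite /closed_runs /open_runs /=; case: (canonical Sigma n). Qed.

Lemma open_runsS (Sigma : shuffling_method) (n : nat) :
  open_runs Sigma n.+1 =
  [seq (o, [:: n]) | o <- closed_runs Sigma n] ++
  ([seq (od.1, rcons od.2 n) | od <- open_runs Sigma n] ++
   [seq (od.1, shuffle Sigma (rcons od.2 n)) | od <- open_runs Sigma n]).
Proof. by rewrite /closed_runs /open_runs /=; case: (canonical Sigma n). Qed.

Lemma size_canonical (Sigma : shuffling_method) (n : nat) :
  size (closed_runs Sigma n) + size (open_runs Sigma n) = fib (2 * n + 1) /\
  size (open_runs Sigma n) = fib (2 * n).
Proof.
elim: n => [|n [IHsum IHopen]] //.
rewrite closed_runsS open_runsS !size_cat !size_map.
rewrite (_ : 2 * n.+1 + 1 = (2 * n).+3); last by lia.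
rewrite (_ : 2 * n.+1 = (2 * n).+2); last by lia.
move: IHsum; rewrite addn1.
rewrite [fib _.+3]/(fib (2 * n).+1 + fib (2 * n) + fib (2 * n).+1).
rewrite [fib _.+2]/(fib (2 * n).+1 + fib (2 * n)).
by lia.
Qed.

Lemma open_runs_neq0 (Sigma : shuffling_method) (n : nat) o d :
  (o, d) \in open_runs Sigma n -> d != [::].
Proof.
case: n => [|n]; rewrite // open_runsS !mem_cat.
case/or3P => /mapP[od _ [_ ->]] //; rewrite -size_eq0 ?size_shuffle size_rcons //.
Qed.

Lemma canonical_perm (Sigma : shuffling_method) (n : nat) :
  (forall o, o \in closed_runs Sigma n -> perm_eq o (iota 0 n)) /\
  (forall o d, (o, d) \in open_runs Sigma n -> perm_eq (o ++ d) (iota 0 n)).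
Proof.
elim: n => [|n [IHclosed IHopen]]; first by split=> // o; rewrite inE => /eqP ->.
have perm_last s : perm_eq s (iota 0 n) -> perm_eq (rcons s n) (iota 0 n.+1).
  by rewrite -addn1 iotaD -cats1 perm_cat2r.
have perm_open o d : (o, d) \in open_runs Sigma n ->
    perm_eq (o ++ rcons d n) (iota 0 n.+1).
  by move=> /IHopen /perm_last; rewrite rcons_cat.
have perm_shuffled o d : (o, d) \in open_runs Sigma n ->
    perm_eq (o ++ shuffle Sigma (rcons d n)) (iota 0 n.+1).
  move=> /perm_open; apply: perm_trans.
  by rewrite perm_cat2l perm_shuffle.
split=> [o|o d]; rewrite ?closed_runsS ?open_runsS !mem_cat.
  case/orP => /mapP[]; first by move=> o' /IHclosed /perm_last ? ->.
  by move=> [o' d'] /perm_shuffled ? ->.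
case/or3P => /mapP[].
- by move=> o' /IHclosed /perm_last ? [-> ->]; rewrite cats1.
- by move=> [o' d'] /perm_open ? [-> ->].
- by move=> [o' d'] /perm_shuffled ? [-> ->].
Qed.

Lemma open_runs_fresh (Sigma : shuffling_method) (n : nat) o d :
  (o, d) \in open_runs Sigma n -> (n \notin o) && (n \notin d).
Proof.
move=> /(proj2 (canonical_perm Sigma n)) /perm_mem/(_ n).
by rewrite mem_cat mem_iota /= add0n ltnn => /norP[-> ->].
Qed.

(** The letter [n] marks where the last block starts in both words. *)
Lemma cat_cons_fresh_inj {T : eqType} (x : T) (s1 s2 t1 t2 : seq T) :
  x \notin s1 -> x \notin s2 -> s1 ++ x :: t1 = s2 ++ x :: t2 -> s1 = s2.
Proof.
elim: s1 s2 => [|y s1 IHs] [|z s2] //=; rewrite ?inE ?negb_or.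
- by move=> _ /andP[/eqP + _] [].
- by move=> /andP[/eqP xy _] _ [/esym].
by move=> /andP[_ xs1] /andP[_ xs2] [-> /IHs ->].
Qed.

Lemma uniq_canonical (Sigma : shuffling_method) (n : nat) :
  back_front Sigma ->
  uniq (closed_runs Sigma n) && uniq (open_runs Sigma n).
Proof.
move=> bfS; elim: n => [|n /andP[IHclosed IHopen]] //.
(* The dichotomy that separates shuffled from unshuffled contents. *)
have last_shuffle o d : (o, d) \in open_runs Sigma n ->
    last 0 (shuffle Sigma (rcons d n)) != n.
  move=> od_in; have /andP[_ nd] := open_runs_fresh Sigma n o d od_in.
  have [t -> perm_td] := @shuffle_rcons Sigma _ d n bfS (open_runs_neq0 _ _ _ _ od_in).
  have t_neq0 : t != [::].
    by rewrite -size_eq0 (perm_size perm_td) size_eq0 (open_runs_neq0 _ _ _ _ od_in).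
  apply: contra nd => /eqP {1}<-; rewrite -(perm_mem perm_td).
  by case: t t_neq0 {perm_td} => //= y t _; rewrite mem_last.
have shuffle_last o d o' : (o, d) \in open_runs Sigma n ->
    last 0 (o' ++ shuffle Sigma (rcons d n)) = last 0 (shuffle Sigma (rcons d n)).
  move=> od_in; rewrite last_cat.
  by have [t -> _] := @shuffle_rcons Sigma _ d n bfS (open_runs_neq0 _ _ _ _ od_in).
rewrite closed_runsS open_runsS !cat_uniq -!andbA; apply/and5P; split.
- by rewrite map_inj_uniq //; apply: rcons_injl.
- apply/hasPn => _ /mapP[[o d] od_in ->]; apply/negP => /mapP[o' _ Eo].
  have := last_shuffle _ _ od_in.
  by rewrite -(shuffle_last o d o) // Eo last_rcons eqxx.
- rewrite map_inj_in_uniq // => -[o1 d1] [o2 d2] in1 in2 /= Eod.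
  have Eo : o1 = o2.
    have /andP[no1 _] := open_runs_fresh _ _ _ _ in1.
    have /andP[no2 _] := open_runs_fresh _ _ _ _ in2.
    move: Eod.
    have [t1 -> _] := @shuffle_rcons Sigma _ d1 n bfS (open_runs_neq0 _ _ _ _ in1).
    have [t2 -> _] := @shuffle_rcons Sigma _ d2 n bfS (open_runs_neq0 _ _ _ _ in2).
    exact: cat_cons_fresh_inj.
  move: Eod; rewrite Eo => /(congr1 (drop (size o2))).
  by rewrite !drop_size_cat // => /shuffle_inj /(@rcons_injl _ n) ->.
- by rewrite map_inj_uniq // => o1 o2 [].
- apply/and4P; split.
  + (* Only the blocks just started have a single letter. *)
    apply/hasPn => -[o d] /=; rewrite mem_cat => od_in.
    apply/negP => /mapP[o' _ [_ Ed]]; case/orP: od_in => /mapP[[o1 d1] in1 [_ Ed1]].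
      have := open_runs_neq0 _ _ _ _ in1.
      by rewrite -size_eq0 -eqSS -(size_rcons d1 n) -Ed1 Ed.
    have := open_runs_neq0 _ _ _ _ in1.
    by rewrite -size_eq0 -eqSS -(size_rcons d1 n) -(size_shuffle Sigma) -Ed1 Ed.
  + by rewrite map_inj_uniq // => -[o1 d1] [o2 d2] [-> /(@rcons_injl _ n) ->].
  + apply/hasPn => _ /mapP[[o d] od_in ->]; apply/negP => /mapP[[o' d'] _ [_ Ed]].
    by have := last_shuffle _ _ od_in; rewrite Ed last_rcons eqxx.
  + by rewrite map_inj_uniq // => -[o1 d1] [o2 d2] [-> /shuffle_inj /(@rcons_injl _ n) ->].
Qed.

(** * Every run has the same result as a canonical one *)

Definition may_follow (a b : operation) : bool := ~~ (is_shuffle a && is_shuffle b).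

(** A word of operations may be thought of as preceded by a push, which allows
    any operation next; runs can then be extended without treating the empty
    word apart. *)
Lemma no_consecutive_shufflesE (ops : seq operation) :
  no_consecutive_shuffles ops = path may_follow Push ops.
Proof. by case: ops. Qed.

(** The invariant of a run on 0, ..., n-1 whose last operation is [a], when
    the letters below [j] have been read.  An open content is a legitimate
    canonical one and popping it would also give a canonical result; as a
    shuffle only acts on contents that were just pushed to, the last clause
    keeps track of the content before that push. *)
Definition run_invariant (Sigma : shuffling_method) (n : nat) (a : operation)
    (c : config nat) : Prop :=
  exists j k, [/\ j + k = n /\ inp c = iota j k,
    out c ++ dev c \in closed_runs Sigma j,
    dev c != [::] -> (out c, dev c) \in open_runs Sigma j &
    ~~ is_shuffle a -> dev c != [::] ->
    exists i d, [/\ j = i.+1, dev c = rcons d i &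
      d != [::] -> (out c, d) \in open_runs Sigma i]].

(** A shuffle acts on [rcons d i] with [(out, d)] open at [i] by the last clause
    of the invariant, so its result is one of the canonical successors of that
    state; a push onto an unfinished block [d] can also be read, for the sake of
    the output, as popping [d] and treating the new letter as its own block. *)
Lemma step_invariant (Sigma : shuffling_method) (n : nat) (a b : operation)
    (c c' : config nat) :
  back_front Sigma -> may_follow a b -> pop_queue_step Sigma b c c' ->
  run_invariant Sigma n a c -> run_invariant Sigma n b c'.
Proof.
move=> bfS + step; case: step => [x i d o|i d o d_gt0|i d o sigma d_gt1] /=.
- move=> _ [j [[|k] [[/= En Ei] closed open _]]] //.
  case: Ei => -> ->; exists j.+1, k; split=> /=.
  + by rewrite addSnnS.
  + by rewrite -rcons_cat closed_runsS mem_cat (map_f (fun o => rcons o j) closed).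
  + move=> _; rewrite open_runsS !mem_cat.
    case: (altP (d =P [::])) => [d0|/open od_in].
      by move: closed; rewrite d0 cats0 => /(map_f (fun o => (o, [:: j]))) ->.
    by rewrite (map_f (fun od => (od.1, rcons od.2 j)) od_in) orbT.
  + by move=> _ _; exists j, d.
- move=> _ [j [k [/= En closed _ _]]]; exists j, k; split=> //=.
  by rewrite cats0.
- move=> sigma_in; rewrite /may_follow andbT => a_push.
  move=> [j [k [/= En _ _ /(_ a_push)]]].
  have d_neq0 : d != [::] by case: d d_gt1 {sigma sigma_in}.
  move=> /(_ d_neq0)[i' [d' [Ej Ed open]]].
  have od_in : (o, d') \in open_runs Sigma i'.
    by apply: open; move: d_gt1; rewrite Ed size_rcons; case: (d').
  have -> : permute sigma = shuffle Sigma (rcons d' i').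
    move: sigma_in; rewrite -Ed back_front_set // => /set1P -> //.
  exists j, k; split=> //=; rewrite Ej.
  + rewrite closed_runsS mem_cat.
    by rewrite (map_f (fun od => od.1 ++ shuffle Sigma (rcons od.2 i')) od_in) orbT.
  + move=> _; rewrite open_runsS !mem_cat.
    by rewrite (map_f (fun od => (od.1, shuffle Sigma (rcons od.2 i'))) od_in) !orbT.
Qed.

Lemma run_closed (Sigma : shuffling_method) (n : nat) (ops : seq operation)
    (s : seq nat) :
  back_front Sigma -> no_consecutive_shuffles ops ->
  pop_queue_run Sigma ops (Config (iota 0 n) [::] [::]) (Config [::] [::] s) ->
  s \in closed_runs Sigma n.
Proof.
move=> bfS; rewrite no_consecutive_shufflesE => ops_ok run.
have: run_invariant Sigma n (last Push ops) (Config [::] [::] s).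
  have: run_invariant Sigma n Push (Config (iota 0 n) [::] [::]).
    by exists 0, n; split.
  elim: run (Push) ops_ok => [c|b {}ops c1 c2 c3 step _ IHrun] a //=.
  by move=> /andP[ab ops_ok] /(step_invariant _ _ _ _ _ _ bfS ab step)/IHrun; apply.
case=> j [[|k] [[/= <- _] closed _ _]] //.
by move: closed; rewrite cats0 addn0.
Qed.

(** * Every canonical run is a run *)

Lemma step_shuffle (Sigma : shuffling_method) {T : Type} (i d o : seq T) :
  back_front Sigma -> 2 <= size d ->
  pop_queue_step Sigma Shuffle (Config i d o) (Config i (shuffle Sigma d) o).
Proof.
by move=> bfS d_gt1; apply: StepShuffle => //; rewrite back_front_set // set11.
Qed.

Definition reachable (Sigma : shuffling_method) {T : Type} (s : seq T)
    (a : operation) (c : config T) : Prop :=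
  exists ops, [/\ path may_follow Push ops, last Push ops = a &
    pop_queue_run Sigma ops (Config s [::] [::]) c].

Lemma reachable_step (Sigma : shuffling_method) {T : Type} (s : seq T)
    (a b : operation) (c c' : config T) :
  may_follow a b -> pop_queue_step Sigma b c c' ->
  reachable Sigma s a c -> reachable Sigma s b c'.
Proof.
move=> ab step [ops [ops_ok lasta run]]; exists (rcons ops b).
rewrite rcons_path last_rcons ops_ok lasta ab; split=> //.
elim: run step {ops_ok lasta} => [c0|e ops' c1 c2 c3 step1 _ IHrun] step /=.
  by apply: RunCons step _; apply: RunNil.
by apply: RunCons step1 (IHrun step).
Qed.

(** Canonical runs interleave shuffles and pops with pushes: every letter pushed
    is followed by at most one shuffle, so no two shuffles are adjacent. *)
Lemma canonical_reachable (Sigma : shuffling_method) (n j k : nat) :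
  back_front Sigma -> j + k = n ->
  (forall o, o \in closed_runs Sigma j ->
     exists a, reachable Sigma (iota 0 n) a (Config (iota j k) [::] o)) /\
  (forall o d, (o, d) \in open_runs Sigma j ->
     exists a, reachable Sigma (iota 0 n) a (Config (iota j k) d o)).
Proof.
move=> bfS; elim: j k => [|j IHj] k En.
  split=> // o; rewrite inE => /eqP ->; exists Push, [::]; split=> //.
  by rewrite -En; apply: RunNil.
have /IHj[IHclosed IHopen] : j + k.+1 = n by rewrite addnS.
have push a d o : reachable Sigma (iota 0 n) a (Config (iota j k.+1) d o) ->
    reachable Sigma (iota 0 n) Push (Config (iota j.+1 k) (rcons d j) o).
  by apply: reachable_step; [rewrite /may_follow andbF | apply: StepPush].
have pop a d o : 0 < size d ->
    reachable Sigma (iota 0 n) a (Config (iota j.+1 k) d o) ->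
    reachable Sigma (iota 0 n) Pop (Config (iota j.+1 k) [::] (o ++ d)).
  by move=> ?; apply: reachable_step; [rewrite /may_follow andbF | apply: StepPop].
have push_shuffle o d : (o, d) \in open_runs Sigma j ->
    reachable Sigma (iota 0 n) Shuffle
      (Config (iota j.+1 k) (shuffle Sigma (rcons d j)) o).
  move=> od_in; have [a /push] := IHopen _ _ od_in.
  apply: reachable_step => //; apply: step_shuffle => //.
  by rewrite size_rcons ltnS lt0n size_eq0 (open_runs_neq0 _ _ _ _ od_in).
split=> [o|o d]; rewrite ?closed_runsS ?open_runsS !mem_cat.
  case/orP => /mapP[].
    move=> o' /IHclosed[a /push reach] ->; exists Pop.
    by rewrite -cats1; apply: pop reach.
  move=> [o' d'] /push_shuffle reach ->; exists Pop.
  by apply: pop reach; rewrite size_shuffle size_rcons.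
case/or3P => /mapP[].
- by move=> o' /IHclosed[a /push reach] [-> ->]; exists Push.
- by move=> [o' d'] /IHopen[a /push reach] [-> ->]; exists Push.
- by move=> [o' d'] /push_shuffle reach [-> ->]; exists Shuffle.
Qed.

Lemma closed_run (Sigma : shuffling_method) (n : nat) (s : seq nat) :
  back_front Sigma -> s \in closed_runs Sigma n ->
  exists2 ops, no_consecutive_shuffles ops &
    pop_queue_run Sigma ops (Config (iota 0 n) [::] [::]) (Config [::] [::] s).
Proof.
move=> bfS s_in.
have [/(_ s s_in)[a [ops [ops_ok _ run]]] _] :=
  canonical_reachable Sigma n n 0 bfS (addn0 n).
by exists ops; rewrite ?no_consecutive_shufflesE.
Qed.

(** * From sortable permutations to outputs *)

Lemma run_map (Sigma : shuffling_method) {T U : Type} (f : T -> U)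
    (ops : seq operation) (c c' : config T) :
  back_front Sigma -> pop_queue_run Sigma ops c c' ->
  pop_queue_run Sigma ops
    (Config (map f (inp c)) (map f (dev c)) (map f (out c)))
    (Config (map f (inp c')) (map f (dev c')) (map f (out c'))).
Proof.
move=> bfS; elim=> [c0|a {}ops c1 c2 c3 step _]; first exact: RunNil.
apply: RunCons.
case: step => [x i d o|i d o d_gt0|i d o sigma d_gt1 sigma_in] /=.
- by rewrite map_rcons; apply: StepPush.
- by rewrite map_cat; apply: StepPop; rewrite size_map.
- have -> : permute sigma = shuffle Sigma d.
    by move: sigma_in; rewrite back_front_set // => /set1P ->.
  by rewrite -shuffle_map; apply: step_shuffle; rewrite ?size_map.
Qed.

(** The letters are moved to [nat] because the recursion defining canonical runs
    changes [n]. *)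
Definition inverse_word (n : nat) (p : 'S_n) : seq nat :=
  [seq val i | i <- one_line p^-1%g].

Lemma map_one_line {n : nat} {T : Type} (f : 'I_n -> T) (p : 'S_n) :
  map f (one_line p) = [seq f (p i) | i <- enum 'I_n].
Proof. by rewrite /one_line -map_comp. Qed.

(** Relabelling a run along [p^-1] turns its input [p] into the identity, and its
    output, the identity, into [p^-1]; relabelling along [p] undoes this. *)
Lemma sortable_inverse (Sigma : shuffling_method) (n : nat) (p : 'S_n.+1) :
  back_front Sigma ->
  pop_queue_sortable Sigma p <-> inverse_word n.+1 p \in closed_runs Sigma n.+1.
Proof.
move=> bfS; rewrite /inverse_word.
split=> [[ops ops_ok run]|/(closed_run Sigma n.+1 _ bfS)[ops ops_ok run]].
  move: run => /(run_map Sigma (fun i => val (p^-1%g i)) ops _ _ bfS).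
  rewrite /inp /dev /out !map_one_line.
  rewrite (eq_map (g := val)) => [|i /=]; last by rewrite permK.
  rewrite val_enum_ord => /(run_closed Sigma n.+1 ops _ bfS ops_ok).
  by rewrite (eq_map (g := fun i => val (p^-1%g i))) // => i /=; rewrite perm1.
exists ops => //.
move: run => /(run_map Sigma (fun k => p (inord k)) ops _ _ bfS).
have run_p : [seq p (inord k) | k <- iota 0 n.+1] = one_line p.
  by rewrite -val_enum_ord -map_comp; apply: eq_map => i; rewrite /= inord_val.
have run_1 : [seq p (inord k) | k <- [seq val (p^-1%g i) | i <- enum 'I_n.+1]] =
    one_line 1%g.
  by rewrite -map_comp; apply: eq_map => i; rewrite /= inord_val permKV perm1.
by rewrite /inp /dev /out map_one_line run_p run_1.
Qed.

Lemma inverse_word_inj (n : nat) : injective (inverse_word n).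
Proof.
move=> p q /(inj_map val_inj)/eq_in_map Epq.
by apply/invg_inj/permP => i; apply: Epq; rewrite mem_enum.
Qed.

Lemma inverse_word_onto (n : nat) (s : seq nat) :
  perm_eq s (iota 0 n) -> exists p, s = inverse_word n p.
Proof.
have size_enum : size (iota 0 n) == n by rewrite size_iota.
move=> /(@tuple_permP _ _ _ (Tuple size_enum))[p ->]; exists p^-1%g.
rewrite /inverse_word invgK map_one_line.
by apply: eq_map => i; rewrite /= (tnth_nth 0) /= nth_iota.
Qed.

Theorem theorem5p7 (Sigma : shuffling_method) (HSigma : back_front Sigma)
    (n : nat) (Hn : 2 <= n) :
  pop_queue_count Sigma n = fib (2 * n - 1).
Proof.
case: n Hn => [|n] // _.
have [size_sum _] := size_canonical Sigma n.
rewrite (_ : 2 * n.+1 - 1 = 2 * n + 1); last by lia.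
rewrite -size_sum /pop_queue_count cardE.
set A := [set p | _].
have -> : size (closed_runs Sigma n) + size (open_runs Sigma n) =
    size (closed_runs Sigma n.+1) by rewrite closed_runsS size_cat !size_map.
have /andP[uniq_closed _] := uniq_canonical Sigma n.+1 HSigma.
rewrite -(size_map (inverse_word n.+1)); apply/perm_size/uniq_perm => //.
  by rewrite (map_inj_uniq (inverse_word_inj n.+1)) enum_uniq.
move=> s; apply/mapP/idP => [[p + ->]|s_in].
  by rewrite mem_enum inE => /asboolP/sortable_inverse; apply.
have [p Es] := inverse_word_onto n.+1 s (proj1 (canonical_perm Sigma n.+1) s s_in).
exists p => //; rewrite mem_enum inE; apply/asboolP/sortable_inverse => //.
by rewrite -Es.
Qed.
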